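(* Let $A\in\mathbb{M}_{m\times n}(\mathbb{C})$ and let $\mathcal{M}$ be a subspace of $\mathbb{M}_{m\times n}(\mathbb{C})$. Let $2\leq p<\infty$ and $1\leq k\leq n_0=\min\{m,n\}$. Let $\mathbb{W}_p^{(k)}$ be the set of all matrices $A-B$ where $B\in\mathcal{M}$ is a best approximation of $A$ in $\mathcal{M}$ with respect to the Ky Fan $p$-$k$ norm. Suppose there is an $R_0^{(p,k)}\in\mathbb{W}_p^{(k)}$ such that $\sigma_k(R_0^{(p,k)})>\sigma_{k+1}(R_0^{(p,k)})$. Then for every $R^{(p,k)}\in\mathbb{W}_p^{(k)}$ and every $1\leq i\leq k$, $$\sigma_i(R_0^{(p,k)})=\sigma_i(R^{(p,k)}).$$
   Context: $\mathbb{M}_{m\times n}(\mathbb{C})$ is the space of complex $m\times n$ matrices, $n_0=\min\{m,n\}$, and $\sigma_1(A)\ge\cdots\ge\sigma_{n_0}(A)$ are the singular values of $A$, with the convention $\sigma_{n_0+1}(A)=0$. For $1\le p<\infty$ and $1\le k\le n_0$ the Ky Fan $p$-$k$ norm is $\|A\|_{(p,k)}=(\sigma_1^p(A)+\cdots+\sigma_k^p(A))^{1/p}$. $B\in\mathcal{M}$ is a best approximation of $A$ with respect to a norm $\|\cdot\|$ if $\|A-B\|=\min_{X\in\mathcal{M}}\|A-X\|$. Subspace means complex linear subspace. *)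

(* Defs.v *)
From mathcomp Require Import all_boot all_order all_algebra.
From mathcomp Require Import spectral sesquilinear.
From mathcomp.real_closed Require Import complex.
From mathcomp Require Import boolp classical_sets reals exp.

Set Implicit Arguments.
Unset Strict Implicit.
Unset Printing Implicit Defensive.

Import Order.TTheory GRing.Theory Num.Theory.
Local Open Scope ring_scope.
Local Open Scope complex_scope.
Local Open Scope sesquilinear_scope.
Local Open Scope classical_set_scope.

(* The min(m, n) singular values in nonincreasing order: square roots of the
   eigenvalues of A^t* A counted with multiplicity. These eigenvalues are the
   entries of [spectral_diag] because A^t* A is Hermitian, hence normal; they
   are real, so taking the real part only casts from R[i] to R. When m < n,
   [take] drops n - m values that are all zero. *)
Definition singular_values (R : realType) (m n : nat) (A : 'M[R[i]]_(m, n)) :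
    seq R :=
  take (minn m n)
    (sort >=%R [seq Num.sqrt (complex.Re (spectral_diag (A^t* *m A) 0 j))
               | j <- enum 'I_n]).

(* Indices start at 1: [sigma A i] is the i-th largest singular value, and it
   is 0 for i > min(m, n). *)
Definition sigma (R : realType) (m n : nat) (A : 'M[R[i]]_(m, n)) (i : nat) : R :=
  (singular_values A)`_i.-1.

Definition kyfan_norm (R : realType) (m n : nat) (p : R) (k : nat)
    (A : 'M[R[i]]_(m, n)) : R :=
  (\sum_(1 <= i < k.+1) sigma A i `^ p) `^ p^-1.

Definition best_approx (R : realType) (m n : nat) (N : 'M[R[i]]_(m, n) -> R)
    (M : {vspace 'M[R[i]]_(m, n)}) (A B : 'M[R[i]]_(m, n)) : Prop :=
  B \in M /\ forall X, X \in M -> N (A - B) <= N (A - X).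

Definition residuals (R : realType) (m n : nat) (p : R) (k : nat)
    (M : {vspace 'M[R[i]]_(m, n)}) (A : 'M[R[i]]_(m, n)) :
    set 'M[R[i]]_(m, n) :=
  [set A - B | B in [set B | best_approx (kyfan_norm p k) M A B]].

(* Main.v *)
(* Let C = (R0 + R1) / 2, which is again of the form A - X with X in M, so its
   Ky Fan norm is at least the common norm of R0 and R1. By the triangle
   inequality for the sums of the j largest singular values, the singular
   values of C are weakly majorized by the averages of those of R0 and R1.
   Since t^p is increasing and strictly convex, this gives
     sum_{i<=k} s_i(C)^p <= sum_{i<=k} ((s_i(R0) + s_i(R1)) / 2)^p
                         <= sum_{i<=k} (s_i(R0)^p + s_i(R1)^p) / 2,
   where the second inequality is strict unless s_i(R0) = s_i(R1) for all
   i <= k. *)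
Require Import Defs.
From mathcomp Require Import all_boot all_order all_algebra.
From mathcomp Require Import all_fingroup spectral sesquilinear ring lra.
From mathcomp.real_closed Require Import complex.
From mathcomp Require Import boolp classical_sets reals exp.

Set Implicit Arguments.
Unset Strict Implicit.
Unset Printing Implicit Defensive.

Import Order.TTheory GRing.Theory Num.Theory.
Local Open Scope ring_scope.
Local Open Scope complex_scope.
Local Open Scope sesquilinear_scope.

(** * Tangent-line inequalities for real powers *)

Section PowerFunction.
Variable R : realType.
Implicit Types a b p : R.

(** Young's inequality for [x * 1] with conjugate exponents [p] and [p / (p - 1)], multiplied by
    [p]; the case [p = 1] is separate. *)
Lemma powR_bernoulli p x : 1 <= p -> 0 <= x -> 1 + p * (x - 1) <= x `^ p :> R.
Proof.
move=> p1 x0; have p0 : 0 < p by lra.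
move: p1; rewrite le_eqVlt => /predU1P[<-|p1]; first by rewrite powRr1//; lra.
have q0 : 0 < 1 - p^-1 by rewrite subr_gt0 invf_lt1.
have := @conjugate_powR _ x 1 p (1 - p^-1)^-1 x0 ler01 p0.
rewrite invr_gt0 invrK powR1 mulr1 mul1r => /(_ q0 ltac:(ring)).
rewrite -(ler_pM2r p0) mulrDl mulfVK ?gt_eqF// mulrBl mulVf ?gt_eqF//.
by lra.
Qed.

(** For [a > 0] this is Bernoulli's inequality at [b / a], scaled by the [p]-th power of [a]. *)
Lemma powR_tangent_le p a b : 1 <= p -> 0 <= a -> 0 <= b ->
  a `^ p + p * a `^ (p - 1) * (b - a) <= b `^ p.
Proof.
move=> p1; rewrite le_eqVlt => /predU1P[<-|a0] b0.
  rewrite powR0 ?add0r; last by apply: lt0r_neq0; lra.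
  move: p1; rewrite le_eqVlt => /predU1P[<-|p1].
    (* Here the slope contains 0 to the power 0, which is 1, so both sides equal [b]. *)
    by rewrite subrr powRr0 powRr1//; lra.
  by rewrite powR0 ?mulr0 ?mul0r ?powR_ge0// subr_eq0 gt_eqF.
have p0 : 0 < p by lra.
have a0' := ltW a0.
have ba0 : 0 <= b / a by rewrite divr_ge0.
have := powR_bernoulli p1 ba0.
rewrite -(ler_pM2l (powR_gt0 p a0)) -powRM//.
rewrite [a * _]mulrC mulfVK ?gt_eqF//; apply: le_trans.
rewrite -(mulr_powRB1 a0' p0) le_eqVlt; apply/orP; left; apply/eqP.
by field; rewrite gt_eqF.
Qed.

(* Strictness comes from [b^p = (b^2)^(p/2)], the tangent inequality for the
   exponent [p/2 >= 1], and [b^2 > a^2 + 2a(b - a)]. *)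
Lemma powR_tangent_lt p a b : 2 <= p -> 0 <= a -> 0 <= b -> a != b ->
  a `^ p + p * a `^ (p - 1) * (b - a) < b `^ p.
Proof.
move=> p2; rewrite le_eqVlt => /predU1P[<-|a0] b0 neq.
  have [pn0 p1n0] : p != 0 /\ p - 1 != 0 by split; apply: lt0r_neq0; lra.
  by rewrite !powR0// mulr0 mul0r addr0 powR_gt0// lt0r b0 eq_sym neq.
have a0' := ltW a0.
have sqE (x : R) : 0 <= x -> x `^ p = (x ^+ 2) `^ (p / 2).
  by move=> x0; rewrite -powR_mulrn// -powRrM; congr (_ `^ _); field.
have p1 : 1 <= p / 2 by lra.
rewrite (sqE b)//.
apply: lt_le_trans (powR_tangent_le p1 (sqr_ge0 a) (sqr_ge0 b)).
rewrite -sqE// ltrD2l.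
have -> : a `^ (p - 1) = a * (a ^+ 2) `^ (p / 2 - 1).
  rewrite -powR_mulrn// -powRrM -[X in X * _]powRr1//.
  by rewrite -powRD ?(gt_eqF a0) ?implybT//; congr (_ `^ _); lra.
have y0 : 0 < (a ^+ 2) `^ (p / 2 - 1) by rewrite powR_gt0 ?exprn_gt0.
set y := _ `^ _ in y0 *.
have d0 : 0 < (b - a) ^+ 2 by rewrite exprn_even_gt0//= subr_eq0 eq_sym.
rewrite -subr_gt0.
have -> : p / 2 * y * (b ^+ 2 - a ^+ 2) - p * (a * y) * (b - a) =
  p / 2 * y * (b - a) ^+ 2 by field.
by rewrite mulr_gt0// mulr_gt0//; lra.
Qed.

End PowerFunction.

(** * Weak majorization and sums of powers *)

Section Majorization.
Variable R : realType.
Implicit Types (w x c s t : nat -> R) (p : R).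

(** Summation by parts: the sum combines the partial sums of [x] with coefficients [w i - w i.+1]
    and, for the full sum, the last [w i]. *)
Lemma abel_sum_ge w x k :
  (forall i, (i < k)%N -> 0 <= w i) ->
  (forall i, (i.+1 < k)%N -> w i.+1 <= w i) ->
  (forall j, (j <= k)%N -> 0 <= \sum_(i < j) x i) ->
  0 <= \sum_(i < k) w i * x i.
Proof.
move=> w0 wS x0.
case: k w0 wS x0 => [|k] w0 wS x0; first by rewrite big_ord0.
suff H j : (j <= k)%N -> w j * \sum_(i < j.+1) x i <= \sum_(i < j.+1) w i * x i.
  by apply: le_trans (H k _); rewrite // mulr_ge0 ?w0 ?x0.
elim: j => [_|j IH jk]; first by rewrite !big_ord1.
rewrite big_ord_recr [leRHS]big_ord_recr /= mulrDr lerD2r.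
apply: le_trans (IH (ltnW jk)).
by rewrite ler_wpM2r ?wS// x0// ltnW.
Qed.

Lemma sum_powR_le_midpoint_eq p c s t k : 2 <= p ->
  (forall i, (i < k)%N -> 0 <= c i) ->
  (forall i, (i < k)%N -> 0 <= s i) ->
  (forall i, (i < k)%N -> 0 <= t i) ->
  (forall i, (i.+1 < k)%N -> c i.+1 <= c i) ->
  (forall j, (j <= k)%N ->
    \sum_(i < j) c i <= \sum_(i < j) ((s i + t i) / 2)) ->
  (\sum_(i < k) s i `^ p + \sum_(i < k) t i `^ p) / 2 <=
    \sum_(i < k) c i `^ p ->
  forall i, (i < k)%N -> s i = t i.
Proof.
move=> p2 c0 s0 t0 cS cst le_pow i ik; apply/eqP; apply: contraT => neq.
pose m i := (s i + t i) / 2.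
have m0 j : (j < k)%N -> 0 <= m j.
  by move=> jk; have := s0 _ jk; have := t0 _ jk; rewrite /m; lra.
have p1 : 1 <= p by lra.
have le_cm : \sum_(i < k) c i `^ p <= \sum_(i < k) m i `^ p.
  (* First-order term of the tangent inequalities at [c i]. The slopes are nonnegative and
     nonincreasing, so Abel summation applies to the majorization hypothesis. *)
  have H : 0 <= \sum_(i < k) (p * c i `^ (p - 1)) * (m i - c i).
    apply: (@abel_sum_ge (fun i => p * c i `^ (p - 1)) (fun i => m i - c i)).
    - by move=> j jk; rewrite mulr_ge0 ?powR_ge0//; lra.
    - move=> j jk; rewrite ler_wpM2l//; first by lra.
      by rewrite ge0_ler_powR ?nnegrE ?c0 ?cS//; [lra | rewrite ltnW].
    - by move=> j jk; rewrite sumrB subr_ge0 cst.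
  rewrite -subr_ge0 -sumrB; apply: le_trans H _; apply: ler_sum => j _.
  by have := powR_tangent_le p1 (c0 _ (ltn_ord j)) (m0 _ (ltn_ord j)); lra.
(* Add the tangent inequalities at the midpoint, taken at [a] and at [b]: the linear terms
   cancel. *)
have mid (a b : R) : 0 <= a -> 0 <= b ->
    ((a + b) / 2) `^ p <= (a `^ p + b `^ p) / 2 ?= iff (a == b).
  move=> a0 b0; have ab0 : 0 <= (a + b) / 2 by lra.
  set y := (a + b) / 2 in ab0 *; set d := p * y `^ (p - 1).
  have dE : d * (a - y) + d * (b - y) = 0 by rewrite /y; field.
  split.
    have := powR_tangent_le p1 ab0 a0; have := powR_tangent_le p1 ab0 b0.
    by rewrite -/d; lra.
  apply/eqP/eqP => [|eq_ab]; last first.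
    have -> : y = b by rewrite /y eq_ab; field.
    by rewrite eq_ab; field.
  move=> eq_y; apply/eqP; apply: contraT => neq_ab.
  have ya : y != a.
    by apply: contra neq_ab => /eqP; rewrite /y => ?; apply/eqP; lra.
  have yb : y != b.
    by apply: contra neq_ab => /eqP; rewrite /y => ?; apply/eqP; lra.
  have := powR_tangent_lt p2 ab0 a0 ya; have := powR_tangent_lt p2 ab0 b0 yb.
  by rewrite -/d; lra.
have : \sum_(i < k) m i `^ p < \sum_(i < k) ((s i `^ p + t i `^ p) / 2).
  rewrite (bigD1 (Ordinal ik))//= [ltRHS](bigD1 (Ordinal ik))//=.
  apply: ltr_leD.
    by rewrite (lt_leif (mid _ _ (s0 _ ik) (t0 _ ik))) neq.
  by apply: ler_sum => j _; apply: mid; rewrite ?s0 ?t0.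
by rewrite -mulr_suml big_split /=; lra.
Qed.

(** Termwise, right side minus left side is at least [s j] times the indicator of [l < j] minus
    [d l], and these differences have a nonnegative sum. *)
Lemma weighted_sum_le_prefix n j s (d : 'I_n -> R) : (j <= n)%N ->
  0 <= s j -> {homo s : x y / (x <= y)%N >-> y <= x} ->
  (forall l, 0 <= d l <= 1) -> \sum_l d l <= j%:R ->
  \sum_(l < n) s l * d l <= \sum_(l < j) s l.
Proof.
move=> jn sj0 sS d01 dj.
have -> : \sum_(l < j) s l = \sum_(l < n) s l * (l < j)%:R.
  rewrite (big_ord_widen _ s jn) [LHS]big_mkcond; apply: eq_bigr => l _.
  by case: ltnP; rewrite ?mulr1 ?mulr0.
have jE : \sum_(l < n) (l < j)%:R = j%:R :> R.
  have <- : \sum_(l < j) 1 = j%:R :> R by rewrite sumr_const card_ord.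
  rewrite (big_ord_widen _ (fun=> 1) jn) [RHS]big_mkcond.
  by apply: eq_bigr => l _; case: ltnP.
rewrite -subr_ge0 -sumrB.
have : 0 <= s j * \sum_(l < n) ((l < j)%:R - d l).
  by rewrite mulr_ge0// sumrB jE subr_ge0.
move=> /le_trans; apply; rewrite mulr_sumr; apply: ler_sum => l _.
rewrite -subr_ge0 -mulrBr -mulrBl; have /andP[d0 d1] := d01 l.
case: ltnP => [lj|jl].
  by apply: mulr_ge0; rewrite subr_ge0// sS// ltnW.
by rewrite sub0r mulrN -mulNr opprB mulr_ge0// subr_ge0 sS.
Qed.

End Majorization.

(** * Partial isometries and Bessel's inequality *)

Section ConjugateTranspose.
Variable C : numClosedFieldType.

Lemma adjmx_mul m n r (A : 'M[C]_(m, n)) (B : 'M[C]_(n, r)) :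
  (A *m B)^t* = B^t* *m A^t*.
Proof. by rewrite trmx_mul map_mxM. Qed.

Lemma adjmxB m n (A B : 'M[C]_(m, n)) : (A - B)^t* = A^t* - B^t*.
Proof. by rewrite linearB /= map_mxB. Qed.

Lemma adjmx1 n : (1%:M : 'M[C]_n)^t* = 1%:M.
Proof. by rewrite trmx1 map_mx1. Qed.

Lemma mul_adjmx_diag m n (A : 'M[C]_(m, n)) j :
  (A^t* *m A) j j = \sum_i `|A i j| ^+ 2.
Proof. by rewrite !mxE; apply: eq_bigr => i _; rewrite !mxE mulrC normCK. Qed.

Definition partial_isometry m n (F : 'M[C]_(m, n)) := F *m F^t* *m F = F.

Lemma partial_isometry_adj m n (F : 'M[C]_(m, n)) :
  partial_isometry F -> partial_isometry (F^t*).
Proof. by rewrite /partial_isometry -[in LHS]mulmxA -!adjmx_mul => ->. Qed.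

Lemma unitarymx_partial_isometry n (Q : 'M[C]_n) :
  Q \is unitarymx -> partial_isometry Q.
Proof. by move/unitarymxP; rewrite /partial_isometry => ->; rewrite mul1mx. Qed.

(** The matrix [E = 1 - F F^*] is an orthogonal projection, and the difference of the two sides is a
    diagonal entry of [(E X)^* (E X)]. *)
Lemma partial_isometry_bessel m n r (F : 'M[C]_(m, n)) (X : 'M[C]_(m, r)) j :
  partial_isometry F -> ((F^t* *m X)^t* *m (F^t* *m X)) j j <= (X^t* *m X) j j.
Proof.
move=> Fp; set E : 'M[C]_m := 1%:M - F *m F^t*.
have EE : E^t* *m E = E.
  rewrite /E adjmxB adjmx1 adjmx_mul trmxCK mulmxBl mul1mx mulmxBr mulmx1.
  by rewrite mulmxA Fp subrr subr0.
have : 0 <= ((E *m X)^t* *m (E *m X)) j j.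
  by rewrite mul_adjmx_diag sumr_ge0// => i _; rewrite exprn_ge0.
rewrite adjmx_mul -!mulmxA (mulmxA _ E) EE /E mulmxBl mul1mx mulmxBr.
by rewrite adjmx_mul trmxCK !mulmxA !mxE subr_ge0.
Qed.

Lemma partial_isometry_col_le1 m n (F : 'M[C]_(m, n)) j :
  partial_isometry F -> \sum_i `|F i j| ^+ 2 <= 1.
Proof.
move=> /partial_isometry_adj Fp; rewrite -mul_adjmx_diag.
have := partial_isometry_bessel 1%:M j Fp.
by rewrite trmxCK mulmx1 adjmx1 mul1mx [leRHS]mxE eqxx.
Qed.

(** [F^* G] need not be a partial isometry, but Bessel for [F] reduces its columns to those of [G].
    With the row version, this makes the squared moduli of the entries doubly substochastic. *)
Lemma partial_isometry_mul_col_le1 m n r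
    (F : 'M[C]_(m, n)) (G : 'M[C]_(m, r)) j :
  partial_isometry F -> partial_isometry G ->
  \sum_i `|(F^t* *m G) i j| ^+ 2 <= 1.
Proof.
move=> Fp Gp; rewrite -mul_adjmx_diag.
apply: le_trans (partial_isometry_bessel _ _ Fp) _.
by rewrite mul_adjmx_diag partial_isometry_col_le1.
Qed.

Lemma partial_isometry_mul_row_le1 m n r
    (F : 'M[C]_(m, n)) (G : 'M[C]_(m, r)) i :
  partial_isometry F -> partial_isometry G ->
  \sum_j `|(F^t* *m G) i j| ^+ 2 <= 1.
Proof.
move=> Fp Gp; apply: le_trans (partial_isometry_mul_col_le1 i Gp Fp).
apply: ler_sum => j _.
have -> : (F^t* *m G) i j = (((G^t* *m F)^t*) i j) by rewrite adjmx_mul trmxCK.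
by rewrite !mxE norm_conjC.
Qed.

End ConjugateTranspose.

(** * Singular value decomposition and Ky Fan's maximum principle *)

Section KyFan.
Variable R : realType.

(* All [n] square roots of the eigenvalues of [A^* A], without the truncation to
   [minn m n] entries made in [singular_values]; only the first
   [k <= minn m n] of them ever matter. *)
Definition sorted_sv m n (A : 'M[R[i]]_(m, n)) : seq R :=
  sort >=%R [seq Num.sqrt (complex.Re (spectral_diag (A^t* *m A) 0 j))
            | j <- enum 'I_n].

(* The columns of [F] attached to zero singular values are zero, so that [F] is
   only a partial isometry; no orthonormal basis has to be completed. *)
Lemma sorted_sv_svd m n (A : 'M[R[i]]_(m, n)) :
  exists (F : 'M[R[i]]_(m, n)) (Q : 'M[R[i]]_n),
    let S := diag_mx (\row_j ((sorted_sv A)`_j)%:C) in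
  [/\ partial_isometry F, partial_isometry Q, A = F *m S *m Q
    & F^t* *m A *m Q^t* = S].
Proof.
set H := A^t* *m A; set P := spectralmx H; set d := spectral_diag H.
have /orthomx_spectralP HE : H \is normalmx.
  by apply/normalmxP; rewrite /H adjmx_mul trmxCK.
rewrite -/P -/d in HE.
have Pu : P \is unitarymx by apply: spectral_unitarymx.
rewrite invmx_unitary// in HE.
pose s := [tuple Num.sqrt (complex.Re (d 0 j)) | j < n].
have /tuple_permP[pi sortE] : perm_eq (sorted_sv A) s.
  by rewrite /sorted_sv perm_sort; apply: perm_refl.
have svE (j : 'I_n) : (sorted_sv A)`_j = Num.sqrt (complex.Re (d 0 (pi j))).
  by rewrite sortE -tnth_nth !tnth_mktuple.
(* The rows of [Q] are the eigenvectors reordered to match the sorted singular values, so [G] has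
   orthogonal columns. *)
pose Q := perm_mx pi *m P; pose G := A *m Q^t*.
have permM : (perm_mx pi : 'M[R[i]]_n)^t* = perm_mx pi^-1.
  by rewrite tr_perm_mx map_perm_mx.
have Qu : Q \is unitarymx.
  apply: mul_unitarymx Pu; apply/unitarymxP.
  by rewrite permM -perm_mxM mulgV perm_mx1.
have QQ : Q^t* *m Q = 1%:M by apply: mulmx1C; apply/unitarymxP.
have GG : G^t* *m G = diag_mx (\row_j d 0 (pi j)).
  rewrite adjmx_mul trmxCK mulmxA -[Q *m _ *m _]mulmxA -/H HE.
  rewrite /Q adjmx_mul permM !mulmxA (mulmxtVK _ Pu) -!mulmxA.
  rewrite (mulmxA P) (unitarymxP Pu) mul1mx -col_permE -row_permE.
  by apply/matrixP => i j; rewrite !mxE (inj_eq perm_inj).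
have d_ge0 j : 0 <= d 0 (pi j).
  have : 0 <= (G^t* *m G) j j.
    by rewrite mul_adjmx_diag sumr_ge0// => i _; rewrite exprn_ge0.
  by rewrite GG !mxE eqxx.
pose sv (j : 'I_n) : R := (sorted_sv A)`_j.
have dE j : d 0 (pi j) = (sv j ^+ 2)%:C.
  have := d_ge0 j; rewrite /sv svE lecE /= => /andP[/eqP im0 re0].
  by rewrite sqr_sqrtr// [LHS]complexE im0 mulr0 addr0.
(* As [0^-1 = 0], this is the pseudoinverse of [S]; [G *m T] normalizes the nonzero columns of
   [G]. *)
pose T := diag_mx (\row_j ((sv j)^-1)%:C).
pose S := diag_mx (\row_j (sv j)%:C).
have diagC (u : 'I_n -> R) :
    (diag_mx (\row_j (u j)%:C))^t* = diag_mx (\row_j (u j)%:C).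
  rewrite tr_diag_mx map_diag_mx; congr diag_mx; apply/rowP => j.
  by rewrite !mxE; apply: conjc_real.
have diagM (u v : 'I_n -> R) : diag_mx (\row_j (u j)%:C) *m
    diag_mx (\row_j (v j)%:C) = diag_mx (\row_j (u j * v j)%:C).
  rewrite mulmx_diag; congr diag_mx; apply/rowP => j.
  by rewrite !mxE rmorphM.
have {}GG : G^t* *m G = S *m S.
  rewrite GG diagM; congr diag_mx; apply/rowP => j.
  by rewrite !mxE dE expr2.
have TSS : T *m (S *m S) = S.
  rewrite !diagM; congr diag_mx; apply/rowP => j; rewrite !mxE; congr _%:C.
  have [->|nz] := eqVneq (sv j) 0; first by rewrite !mulr0.
  by rewrite mulrA mulVf ?mul1r.
have TST : T *m S *m T = T.
  rewrite !diagM; congr diag_mx; apply/rowP => j; rewrite !mxE; congr _%:C.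
  have [->|nz] := eqVneq (sv j) 0; first by rewrite invr0 !mulr0.
  by rewrite mulVf ?mul1r.
have TC : T^t* = T by apply: diagC.
(* A column of [G] with zero singular value has squared norm 0, hence vanishes. *)
have GTS : G *m T *m S = G.
  apply/eqP; rewrite -subr_eq0; apply/eqP/matrixP => i j.
  rewrite [RHS]mxE -mulmxA diagM mul_mx_diag.
  have [sv0|nz] := eqVneq (sv j) 0; last first.
    by rewrite !mxE mulVf// mulr1 subrr.
  have : (G^t* *m G) j j = 0 by rewrite GG diagM !mxE eqxx sv0 mulr0.
  rewrite mul_adjmx_diag => /eqP; rewrite psumr_eq0; last first.
    by move=> l _; rewrite exprn_ge0.
  move=> /allP/(_ i (mem_index_enum _)); rewrite sqrf_eq0 normr_eq0 => /eqP Gij.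
  by rewrite !mxE -/(G i j) in Gij *; rewrite Gij mul0r subrr.
have GE : G = A *m Q^t* by [].
clearbody G Q; exists (G *m T), Q; split.
- rewrite /partial_isometry adjmx_mul TC -!mulmxA (mulmxA _ G) GG.
  by rewrite (mulmxA T (S *m S)) TSS (mulmxA T S) TST.
- exact: unitarymx_partial_isometry.
- by rewrite GTS GE -mulmxA QQ mulmx1.
- by rewrite adjmx_mul TC -!mulmxA -GE GG TSS.
Qed.

Lemma sorted_sv_ge0 m n (A : 'M[R[i]]_(m, n)) i : 0 <= (sorted_sv A)`_i.
Proof.
have [lt|ge] := ltnP i (size (sorted_sv A)); last by rewrite nth_default.
have := mem_nth 0 lt; rewrite mem_sort => /mapP[j _ ->].
exact: sqrtr_ge0.
Qed.

Lemma sorted_sv_nonincreasing m n (A : 'M[R[i]]_(m, n)) i j :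
  (i <= j)%N -> (sorted_sv A)`_j <= (sorted_sv A)`_i.
Proof.
move=> ij; have [lt|ge] := ltnP j (size (sorted_sv A)); last first.
  by rewrite [leLHS]nth_default ?sorted_sv_ge0.
apply: (sorted_leq_nth ge_trans ge_refl) => //.
- by apply: sort_sorted; apply: ge_total.
- by rewrite inE (leq_ltn_trans ij).
Qed.

(* The pairing [(U^* A V)_ii] of the columns of [U] and [V] is bounded by an
   average of the singular values with doubly substochastic weights. *)
Lemma ky_fan_max m n (A : 'M[R[i]]_(m, n)) (U : 'M[R[i]]_(m, n))
    (V : 'M[R[i]]_n) j : (j <= n)%N ->
  partial_isometry U -> partial_isometry V ->
  complex.Re (\sum_(i < n | (i < j)%N) (U^t* *m A *m V) i i) <=
  \sum_(i < j) (sorted_sv A)`_i.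
Proof.
move=> jn Up Vp; have [F [Q [Fp Qp AE _]]] := sorted_sv_svd A.
set s := sorted_sv A in AE *.
pose X := U^t* *m F; pose Y := Q *m V.
(* These weights come from bounding the real part of [x * y] by the mean of the squared moduli of
   [x] and [y]. *)
pose D i l := (complex.Re (`|X i l| ^+ 2) + complex.Re (`|Y l i| ^+ 2)) / 2.
have ReD : {morph @complex.Re R : x y / x + y} by case=> [? ?] [? ?].
have ReS (I : finType) (P : pred I) (G : I -> R[i]) :
    complex.Re (\sum_(i | P i) G i) = \sum_(i | P i) complex.Re (G i).
  exact: (big_morph _ ReD).
have Re_sq_ge0 (z : R[i]) : 0 <= complex.Re (`|z| ^+ 2).
  by rewrite -add_Re2_Im2 addr_ge0 ?sqr_ge0.
have D_ge0 i l : 0 <= D i l by rewrite divr_ge0// addr_ge0.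
have Re_le1 (z : R[i]) : z <= 1 -> complex.Re z <= 1.
  by rewrite lecE => /andP[].
have YE : Y = (Q^t*)^t* *m V by rewrite trmxCK.
have Qp' := partial_isometry_adj Qp.
have Dr i : \sum_l D i l <= 1.
  rewrite -mulr_suml big_split /=.
  have := Re_le1 _ (partial_isometry_mul_row_le1 i Up Fp).
  have := Re_le1 _ (partial_isometry_mul_col_le1 i Qp' Vp).
  by rewrite -YE -/X !ReS; lra.
have Dc l : \sum_i D i l <= 1.
  rewrite -mulr_suml big_split /=.
  have := Re_le1 _ (partial_isometry_mul_col_le1 l Up Fp).
  have := Re_le1 _ (partial_isometry_mul_row_le1 l Qp' Vp).
  by rewrite -YE -/X !ReS; lra.
have AXY : U^t* *m A *m V = X *m diag_mx (\row_j (s`_j)%:C) *m Y.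
  by rewrite AE /X /Y !mulmxA.
clearbody X Y.
have Dentry i : complex.Re ((U^t* *m A *m V) i i) <= \sum_(l < n) s`_l * D i l.
  rewrite AXY mxE ReS.
  apply: ler_sum => l _; rewrite mul_mx_diag !mxE /D -!add_Re2_Im2 /=.
  have : 0 <= s`_l by apply: sorted_sv_ge0.
  case: (X i l) (Y l i) => [a b] [c d] /= s0.
  rewrite -subr_ge0.
  set e := (X in 0 <= X).
  (* The gap is half of the singular value times the squared modulus of [x] minus the conjugate of
     [y]. *)
  have -> : e = s`_l * ((a - c) ^+ 2 + (b + d) ^+ 2) / 2 by rewrite /e; field.
  by rewrite divr_ge0// mulr_ge0// addr_ge0 ?sqr_ge0.
rewrite ReS; apply: (le_trans (ler_sum _ (fun i _ => Dentry i))).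
rewrite exchange_big /=.
under eq_bigr do rewrite -mulr_sumr.
apply: (weighted_sum_le_prefix (s := fun l => s`_l)) => //.
- exact: sorted_sv_ge0.
- by move=> x y; apply: sorted_sv_nonincreasing.
- move=> l; rewrite sumr_ge0//=; apply: le_trans (Dc l).
  by rewrite [leRHS](bigID (fun i : 'I_n => (i < j)%N)) /= lerDl sumr_ge0.
- rewrite exchange_big /=.
  have <- : \sum_(l < j) 1 = j%:R :> R by rewrite sumr_const card_ord.
  rewrite (big_ord_widen _ (fun=> 1) jn).
  exact: ler_sum.
Qed.

(** With [F] and [Q] from the decomposition of the midpoint, the diagonal of [F^* Z Q^*] is linear
    in [Z] and gives exactly the singular values at the midpoint; [ky_fan_max] bounds the parts from
    [A] and [B]. *)
Lemma ky_fan_midpoint m n (A B : 'M[R[i]]_(m, n)) j : (j <= n)%N ->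
  \sum_(i < j) (sorted_sv (2^-1 *: (A + B)))`_i <=
  \sum_(i < j) (((sorted_sv A)`_i + (sorted_sv B)`_i) / 2).
Proof.
move=> jn; have [F [Q [Fp Qp _ SE]]] := sorted_sv_svd (2^-1 *: (A + B)).
have Qp' := partial_isometry_adj Qp.
have := ky_fan_max A jn Fp Qp'; have := ky_fan_max B jn Fp Qp'.
set c := sorted_sv (_ *: _) in SE *.
have -> : \sum_(i < j) c`_i = complex.Re (\sum_(i < n | (i < j)%N)
    (2^-1 * ((F^t* *m A *m Q^t*) i i + (F^t* *m B *m Q^t*) i i))).
  rewrite (big_ord_widen _ (fun i => c`_i) jn).
  under [in RHS]eq_bigr => i _.
    have -> : 2^-1 * ((F^t* *m A *m Q^t*) i i + (F^t* *m B *m Q^t*) i i) =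
       (c`_i)%:C.
      have := congr1 (fun M : 'M_n => M i i) SE.
      rewrite -scalemxAr -scalemxAl mulmxDr mulmxDl !mxE eqxx mulr1n.
      by [].
    over.
  by rewrite -rmorph_sum.
rewrite -mulr_sumr big_split /= -mulr_suml big_split /=.
set a := \sum_(i < n | _) (F^t* *m A *m _) i i.
set b := \sum_(i < n | _) (F^t* *m B *m _) i i.
have -> : 2^-1 * (a + b) = ((2^-1 : R)%:C) * (a + b).
  by congr (_ * _); rewrite fmorphV rmorph_nat.
case: a b => [? ?] [? ?] /=; lra.
Qed.

(** * From Ky Fan norms to sums of powers *)

Lemma sigmaE m n (A : 'M[R[i]]_(m, n)) i :
  (i < minn m n)%N -> sigma A i.+1 = (sorted_sv A)`_i.
Proof. by move=> im; rewrite /sigma /singular_values nth_take. Qed.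

Lemma kyfan_normE m n p k (A : 'M[R[i]]_(m, n)) : (k <= minn m n)%N ->
  kyfan_norm p k A = (\sum_(i < k) (sorted_sv A)`_i `^ p) `^ p^-1.
Proof.
move=> kn; rewrite /kyfan_norm big_add1 /= big_mkord.
by congr (_ `^ _); apply: eq_bigr => i _; rewrite sigmaE// (leq_trans _ kn).
Qed.

Lemma kyfan_norm_le_sum m n p k (X Y : 'M[R[i]]_(m, n)) :
  0 < p -> (k <= minn m n)%N -> kyfan_norm p k X <= kyfan_norm p k Y ->
  \sum_(i < k) (sorted_sv X)`_i `^ p <= \sum_(i < k) (sorted_sv Y)`_i `^ p.
Proof.
move=> p0 kmn; rewrite (kyfan_normE _ _ kmn) (kyfan_normE _ _ kmn).
have sum_ge0 Z : 0 <= \sum_(i < k) (@sorted_sv m n Z)`_i `^ p.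
  by rewrite sumr_ge0// => i _; rewrite powR_ge0.
move: (sum_ge0 X) (sum_ge0 Y); set x := \sum_(i < k) _; set y := \sum_(i < k) _.
move=> x0 y0; rewrite leNgt => le_xy; rewrite leNgt; apply: contra le_xy.
by apply: gt0_ltr_powR; rewrite ?nnegrE// invr_gt0.
Qed.

Lemma sorted_sv_midpoint_eq m n (p : R) k (X Y : 'M[R[i]]_(m, n)) :
  2 <= p -> (k <= n)%N ->
  \sum_(i < k) (sorted_sv X)`_i `^ p <=
    \sum_(i < k) (sorted_sv (2^-1 *: (X + Y)))`_i `^ p ->
  \sum_(i < k) (sorted_sv Y)`_i `^ p <=
    \sum_(i < k) (sorted_sv (2^-1 *: (X + Y)))`_i `^ p ->
  forall i, (i < k)%N -> (sorted_sv X)`_i = (sorted_sv Y)`_i.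
Proof.
move=> p2 kn; have := fun j (jk : (j <= k)%N) =>
  ky_fan_midpoint X Y (leq_trans jk kn).
move: (sorted_sv_nonincreasing (2^-1 *: (X + Y))).
move: (sorted_sv_ge0 X) (sorted_sv_ge0 Y) (sorted_sv_ge0 (2^-1 *: (X + Y))).
move: (sorted_sv (_ *: _)) (sorted_sv X) (sorted_sv Y) => c s t.
move=> s0 t0 c0 cS cst Nsc Ntc.
apply: (@sum_powR_le_midpoint_eq _ p (fun i => c`_i) (fun i => s`_i)
  (fun i => t`_i) k) => //; first by move=> *; apply: cS.
by lra.
Qed.

End KyFan.

Theorem theorem3p10 (R : realType) (m n : nat) (A : 'M[R[i]]_(m, n))
    (M : {vspace 'M[R[i]]_(m, n)}) (p : R) (hp : 2 <= p)
    (k : nat) (hk : (1 <= k <= minn m n)%N)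
    (R0 : 'M[R[i]]_(m, n)) (hR0 : residuals p k M A R0)
    (hgap : sigma R0 k > sigma R0 k.+1) :
  forall R1 : 'M[R[i]]_(m, n), residuals p k M A R1 ->
  forall i : nat, (1 <= i <= k)%N -> sigma R0 i = sigma R1 i.
Proof.
have /andP[_ kmn] := hk.
clear hgap; case: hR0 => B0 [B0M B0min] <-.
move=> _ [B1 [B1M B1min] <-] i /andP[i_gt0 ik].
rewrite -(prednK i_gt0) in ik *; move: i.-1 ik => {i_gt0}i ik.
have imn : (i < minn m n)%N := leq_trans ik kmn.
rewrite (sigmaE _ imn) (sigmaE _ imn).
(* A competitor for both minimality conditions: its residual is the midpoint of the two given
   residuals. *)
pose B := 2^-1 *: (B0 + B1).
have BM : B \in M by rewrite rpredZ// rpredD.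
have AB : A - B = 2^-1 *: ((A - B0) + (A - B1)).
  rewrite addrACA -opprD scalerBr -/B -mulr2n -(scaler_nat 2 A) scalerA.
  by rewrite mulVf ?scale1r// pnatr_eq0.
have kn : (k <= n)%N by rewrite (leq_trans kmn)// geq_minr.
have p0 : 0 < p by lra.
have le0 := kyfan_norm_le_sum p0 kmn (B0min _ BM).
have le1 := kyfan_norm_le_sum p0 kmn (B1min _ BM).
rewrite AB in le0 le1.
exact: (sorted_sv_midpoint_eq hp kn le0 le1 ik).
Qed.
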